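(* Let $F$ be a finite field of characteristic $>2$, let $n\ge2$, and let $$S=\{(\xi,\xi\cdot\xi):\xi\in F^{n-1}\}\subset F^n,\qquad \tilde S=\{(\xi,\xi\cdot\xi,\eta,\xi\cdot\eta):\xi,\eta\in F^{n-1}\}\subset F^{2n}.$$ Let $2\le p,q\le\infty$. Then $$R^*_S(p\to q)\le R^*_{\tilde S}(p\to q),$$ $$K\big((q/2)'\to(p/2)'\big)\le R^*_{\tilde S}(p\to q)^2\,|F|^{\,n-1-\frac{2n}{q}},$$ and $$R^*_{\tilde S}(p\to q)\le R^*_S(2\to q)\,K\big((q/2)'\to(p/2)'\big)^{1/2}.$$
   Context: For an exponent $r\in[1,\infty]$, $r'$ is the dual exponent, $1/r+1/r'=1$. $e:F\to S^1\subset\mathbb{C}$ is a fixed non-principal character, i.e. $e(x+y)=e(x)e(y)$ and $e$ is not identically $1$; $x\cdot\xi=\sum_i x_i\xi_i$ on $F^m$ for any $m$. Restriction constants: for a nonempty set $S\subset F^m$ (here $m=n$ for $S$ and $m=2n$ for $\tilde S$), $d\sigma$ is the normalized counting measure on $S$, so $\|g\|_{L^p(S,d\sigma)}=\left(\frac1{|S|}\sum_{\xi\in S}|g(\xi)|^p\right)^{1/p}$ (maximum if $p=\infty$), and $(g\,d\sigma)^\vee(x)=\frac1{|S|}\sum_{\xi\in S}g(\xi)e(x\cdot\xi)$ for $x\in F^m$. $R^*_S(p\to q)$ is the smallest constant such that $\|(g\,d\sigma)^\vee\|_{L^q(F^m,dx)}\le R^*_S(p\to q)\|g\|_{L^p(S,d\sigma)}$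 for all $g:S\to\mathbb{C}$, where $dx$ is counting measure on $F^m$. Kakeya constants: for $x_0,v\in F^{n-1}$ let $l(x_0,v)=\{(x_0+vt,t):t\in F\}\subset F^n$. For $f:F^n\to\mathbb{C}$ define $f^*(v)=\sup_{x_0\in F^{n-1}}\sum_{x\in l(x_0,v)}|f(x)|$ for $v\in F^{n-1}$. $K(p\to q)$ is the smallest constant such that $\|f^*\|_{L^q(F^{n-1},dv)}\le K(p\to q)\|f\|_{L^p(F^n,dx)}$ for all $f$, where $dx$ is counting measure on $F^n$ and $dv$ is normalized counting measure on $F^{n-1}$ (total mass $1$). *)

(* Defs.v *)
From HB Require Import structures.
From mathcomp Require Import all_boot all_order all_algebra.
From mathcomp Require Import complex.
From mathcomp Require Import all_classical all_reals all_analysis.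

Set Implicit Arguments.
Unset Strict Implicit.
Unset Printing Implicit Defensive.

Import Order.TTheory GRing.Theory Num.Theory.
Import ComplexField.Normc.

Local Open Scope ring_scope.
Local Open Scope complex_scope.

(* L^p norm of a function on a finite type whose points all have the same mass
   w > 0 (w = 1: counting measure, w = #|T|^-1: normalized counting measure).
   At p = +oo it is the maximum, which does not depend on w. Only exponents
   in [1, +oo] are meaningful. *)
Definition Lpnorm (R : realType) (T : finType) (w : R) (p : \bar R)
    (a : T -> R) : R :=
  match p with
  | r%:E => (w * \sum_x `|a x| `^ r) `^ r^-1
  | _ => \big[Order.max/0]_x `|a x|
  end.

(* Smallest C such that A g <= C * B g for all g. In the two uses below B is a
   norm on a nonzero finite-dimensional space and A a seminorm on it, so the
   set is nonempty and bounded below and its infimum belongs to it. *)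
Definition smallest_constant (R : realType) (G : Type) (A B : G -> R) : R :=
  inf [set C : R | forall g : G, A g <= C * B g]%classic.

Definition dotp (F : finFieldType) (m : nat) (x y : 'rV[F]_m) : F :=
  \sum_(i < m) x 0 i * y 0 i.

Section Restriction.
Variables (R : realType) (F : finFieldType) (e : F -> R[i]) (m : nat).
Variable S : {set 'rV[F]_m}.

(* (g dsigma)^vee *)
Definition extension (g : {xi | xi \in S} -> R[i]) (x : 'rV[F]_m) : R[i] :=
  (#|S|%:R)^-1 * \sum_xi g xi * e (dotp x (\val xi)).

(* R^*_S(p -> q) *)
Definition restriction_constant (p q : \bar R) : R :=
  smallest_constant
    (fun g : {xi | xi \in S} -> R[i] =>
       Lpnorm 1 q (fun x => normc (extension g x)))
    (fun g => Lpnorm (#|S|%:R)^-1 p (fun xi => normc (g xi))).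

End Restriction.

(* From here on d stands for n - 1, and a point (x, t) of F^n = F^(n-1) * F is
   row_mx x (const_mx t) : 'rV[F]_(d + 1). *)
Section Kakeya.
Variables (R : realType) (F : finFieldType) (d : nat).

Definition line (x0 v : 'rV[F]_d) : {set 'rV[F]_(d + 1)} :=
  [set row_mx (x0 + t *: v) (const_mx t) | t : F].

(* f^* *)
Definition kakeya_maximal (f : 'rV[F]_(d + 1) -> R[i]) (v : 'rV[F]_d) : R :=
  \big[Order.max/0]_(x0 : 'rV[F]_d) \sum_(x in line x0 v) normc (f x).

(* K(p -> q) *)
Definition kakeya_constant (p q : \bar R) : R :=
  smallest_constant
    (fun f : 'rV[F]_(d + 1) -> R[i] =>
       Lpnorm (#|{: 'rV[F]_d}|%:R)^-1 q (kakeya_maximal f))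
    (fun f => Lpnorm 1 p (fun x => normc (f x))).

End Kakeya.

Arguments kakeya_constant {R} F d p q.

Section Paraboloids.
Variables (F : finFieldType) (d : nat).

Definition paraboloid : {set 'rV[F]_(d + 1)} :=
  [set row_mx xi (const_mx (dotp xi xi)) | xi : 'rV[F]_d].

Definition tilde_paraboloid : {set 'rV[F]_((d + 1) + (d + 1))} :=
  [set row_mx (row_mx xi (const_mx (dotp xi xi)))
              (row_mx eta (const_mx (dotp xi eta)))
    | xi : 'rV[F]_d, eta : 'rV[F]_d].

End Paraboloids.

(* Main.v *)
Require Import Defs.
From mathcomp Require Import all_boot all_order all_algebra.
From mathcomp Require Import complex.
From mathcomp Require Import all_classical all_reals all_analysis.

Set Implicit Arguments.
Unset Strict Implicit.
Unset Printing Implicit Defensive.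

Import Order.TTheory GRing.Theory Num.Theory.
Import ComplexField.Normc.

Local Open Scope ring_scope.
Local Open Scope complex_scope.

(** The three inequalities rest on one identity. Write a point of F^(2n) as
    (u, (y, s)) with u in F^n, y in F^(n-1) and s in F. Summing over eta
    first, the extension from the tilde paraboloid of G(xi, eta) becomes, for
    each fixed (y, s), an ordinary extension from the paraboloid:

      (G dsigma~)^vee (u, (y, s)) = (g_(y,s) dsigma)^vee (u),
      g_(y,s)(xi) = G^(xi, y + s xi),

    where G^(xi, .) is the normalized Fourier transform of G(xi, .) in eta
    ([tilde_extension]). As s varies, y + s xi runs over a line of direction
    xi, and this is how the Kakeya operator enters.

    Restriction from S is no harder ([restriction_le_tilde]): if G(xi, eta)
    depends on xi only, the slice y = 0, s = 0 of its extension is the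
    extension from S, with the same norms.

    Kakeya from restriction ([kakeya_le_tilde]): choose for each direction v a
    line with base point x0(v) that attains the maximal function, and weights
    a(v) >= 0. Taking G(xi, eta) = a(-xi)^(1/2) e(-x0(-xi).eta) makes G^(xi, y
    + s xi) equal to a(-xi)^(1/2) when (y, s) is on the line chosen for the
    direction -xi and 0 otherwise. By Plancherel the mean of the squared
    extension over the first block u is then the weighted number of chosen
    lines through (y, s), up to a normalizing factor: averaging over u does
    what random signs on the lines would do. Since q / 2 >= 1, the power mean
    inequality bounds this mean by an L^(q/2) norm in u, so the L^q norm of
    the extension controls the overlap of the lines in L^(q/2)
    ([line_overlap_le]); by duality this is a bound for the maximal function.

    Restriction to S~ from restriction to S and Kakeya
    ([tilde_le_restriction_kakeya]): apply the L^2 restriction estimate on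
    each slice (y, s). What remains is the L^(q/2) norm of the average over xi
    of |G^(xi, y + s xi)|^2. Test it against f(y, s): the terms with y + s xi
    = z fixed collect the values of f along a line of direction -xi, so the
    Kakeya maximal function and Hoelder give a bound by K times the L^(p/2)
    norm in xi of sum_z |G^(xi, z)|^2 ([slice_energy_le]), and Plancherel in
    eta controls the latter by the norm of G ([fiber_energy_le]). *)

(** * Weighted Lp norms on finite types *)

Section Norms.
Context {R : realType}.
Implicit Types (w r s : R) (p q : \bar R).

Lemma Lpnorm_ge0 (T : finType) w p (a : T -> R) : 0 <= Lpnorm w p a.
Proof. by case: p => [r||] /=; [exact: powR_ge0|exact: bigmax_ge_id..]. Qed.

Lemma eq_Lpnorm (T : finType) w p (a b : T -> R) :
  a =1 b -> Lpnorm w p a = Lpnorm w p b.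
Proof. by move=> /funext ->. Qed.

Lemma le_Lpnorm (T : finType) w p (a b : T -> R) : 0 <= w -> (1 <= p)%E ->
  (forall x, `|a x| <= `|b x|) -> Lpnorm w p a <= Lpnorm w p b.
Proof.
move=> w0 p1 ab; case: p p1 => [r||] /= r1; [|by apply: le_bigmax2|by []].
rewrite lee_fin in r1; have r0 : 0 <= r by rewrite (le_trans _ r1).
apply: ge0_ler_powR; rewrite ?invr_ge0 ?nnegrE //.
- by rewrite mulr_ge0// sumr_ge0// => x _; exact: powR_ge0.
- by rewrite mulr_ge0// sumr_ge0// => x _; exact: powR_ge0.
- rewrite ler_wpM2l// ler_sum// => x _.
  by rewrite ge0_ler_powR ?nnegrE.
Qed.

Lemma Lpnorm_abs (T : finType) w p (a : T -> R) :
  Lpnorm w p (fun x => `|a x|) = Lpnorm w p a.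
Proof. by case: p => [r||] /=; under eq_bigr do rewrite normr_id. Qed.

Lemma LpnormZ (T : finType) w p k (a : T -> R) : 0 <= w -> (1 <= p)%E ->
  Lpnorm w p (fun x => k * a x) = `|k| * Lpnorm w p a.
Proof.
move=> w0; case: p => [r||] //=.
  rewrite lee_fin => r1; have r0 : 0 < r by rewrite (lt_le_trans _ r1).
  under eq_bigr do rewrite normrM powRM ?normr_ge0//.
  have m0 : 0 <= w * \sum_x `|a x| `^ r.
    by rewrite mulr_ge0// sumr_ge0// => x _; exact: powR_ge0.
  rewrite -mulr_sumr mulrCA [LHS]powRM ?powR_ge0//.
  by rewrite -powRrM divff ?gt_eqF// powRr1.
move=> _; elim/big_rec2: _ => [|x y1 y2 _ ->]; first by rewrite mulr0.
by rewrite normrM maxr_pMr.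
Qed.

Lemma ge0_LpnormZ (T : finType) w p k (a : T -> R) : 0 <= w -> (1 <= p)%E ->
  0 <= k -> Lpnorm w p (fun x => k * a x) = k * Lpnorm w p a.
Proof. by move=> w0 p1 k0; rewrite LpnormZ// ger0_norm. Qed.

Lemma half_ge1 p : (2%:E <= p -> 1 <= p / 2%:E)%E.
Proof.
case: p => [r||] //=; rewrite inver pnatr_eq0/=; last first.
  by move=> _; rewrite mulyr gtr0_sg ?invr_gt0// mul1e leey.
by rewrite -EFinM !lee_fin ler_pdivlMr// mul1r.
Qed.

Lemma ge2_ge1 p : (2%:E <= p -> 1 <= p)%E.
Proof. by apply: le_trans; rewrite lee_fin ler1n. Qed.

(** All exponents at least 2 are brought down to p / 2 and q / 2 in this way:
    the proof compares squared moduli, and it is for p / 2 and q / 2 that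
    the Kakeya exponents are dual. *)
Lemma Lpnorm_sqr (T : finType) w p (a : T -> R) : (2%:E <= p)%E ->
  Lpnorm w p a ^+ 2 = Lpnorm w (p / 2%:E)%E (fun x => a x ^+ 2).
Proof.
case: p => [r||] //=; rewrite inver pnatr_eq0/=; last first.
  move=> _; rewrite mulyr gtr0_sg ?invr_gt0// mul1e/=.
  apply/esym; elim: (index_enum T) => [|x l IH].
    by rewrite !big_nil expr0n.
  rewrite !big_cons IH normrX.
  set m := \big[_/_]_(j <- l) _.
  have m0 : 0 <= m by exact: bigmax_ge_id.
  case: (leP `|a x| m) => h.
    by rewrite max_r// ler_pXn2r// nnegrE.
  by rewrite max_l// ler_pXn2r ?nnegrE// ltW.
rewrite lee_fin => r2; have r0 : 0 < r by rewrite (lt_le_trans _ r2).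
rewrite -powR_mulrn ?powR_ge0// -powRrM invfM invrK.
congr ((_ * _) `^ _); apply: eq_bigr => x _.
rewrite normrX -powR_mulrn// -powRrM; congr (_ `^ _).
by rewrite mulrC divfK// pnatr_eq0.
Qed.

Lemma Lpnorm_reindex (T U : finType) w p (h : U -> T) (a : T -> R) :
  bijective h -> Lpnorm w p (fun x => a (h x)) = Lpnorm w p a.
Proof.
move=> hb; case: p => [r||] /=.
- by rewrite [in RHS](reindex h)//; exact: onW_bij.
- by rewrite [in RHS](reindex h)//; exact: onW_bij.
- by rewrite [in RHS](reindex h)//; exact: onW_bij.
Qed.

(** Norms over F^(2n) are computed slice by slice; at p = +oo the weights drop
    out, which is why the identity has the same form there. *)
Lemma Lpnorm_prod (T U : finType) w w' p (a : T * U -> R) :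
  0 <= w' -> (1 <= p)%E ->
  Lpnorm (w * w') p a = Lpnorm w p (fun x => Lpnorm w' p (fun y => a (x, y))).
Proof.
move=> w0; case: p => [r||] //=.
  rewrite lee_fin => r1; have r0 : 0 < r by rewrite (lt_le_trans _ r1).
  congr (_ `^ _); rewrite -mulrA; congr (_ * _).
  have -> : \sum_x `|a x| `^ r = \sum_x \sum_y `|a (x, y)| `^ r.
    by rewrite pair_bigA/=; apply: eq_bigr => -[].
  rewrite mulr_sumr.
  apply: eq_bigr => x _.
  rewrite ger0_norm ?powR_ge0// -powRrM mulVf ?gt_eqF// powRr1//.
  by rewrite mulr_ge0// sumr_ge0// => y _; exact: powR_ge0.
move=> _.
apply/eqP; rewrite eq_le; apply/andP; split.
  apply/bigmax_leP; split; first exact: bigmax_ge_id.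
  move=> [x y] _; apply: (bigmax_sup x) => //.
  rewrite [leRHS]ger0_norm ?bigmax_ge_id//.
  exact: (le_bigmax _ (fun y => `|a (x, y)|)).
apply/bigmax_leP; split; first exact: bigmax_ge_id.
move=> x _; rewrite ger0_norm ?bigmax_ge_id//.
apply/bigmax_leP; split; first exact: bigmax_ge_id.
by move=> y _; exact: (le_bigmax _ (fun z => `|a z|) (x, y)).
Qed.

Lemma Lpnorm_const (T : finType) w p k : (1 <= p)%E ->
  w * #|T|%:R = 1 -> Lpnorm w p (fun _ : T => k) = `|k|.
Proof.
move=> p1 wT; have Tn : (0 < #|T|)%N.
  case: posnP wT => // ->; rewrite mulr0 => /esym/eqP.
  by rewrite oner_eq0.
case: p p1 => [r||] //=.
  rewrite lee_fin => r1; have r0 : 0 < r by rewrite (lt_le_trans _ r1).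
  rewrite sumr_const -mulr_natr mulrC -mulrA [_ * w]mulrC wT mulr1.
  by rewrite -powRrM divff ?gt_eqF// powRr1.
move=> _; apply/eqP; rewrite eq_le; apply/andP; split.
  by apply/bigmax_leP; split.
by move/card_gt0P : Tn => [x _]; apply: (bigmax_sup x).
Qed.

(** Passing from counting to normalized measure costs a power of the total
    mass. At p = +oo the exponent [fine p^-1] is 0, so that one formula serves
    all exponents; this is the source of the power of |F| in the second
    inequality. *)
Lemma Lpnorm_weight (T : finType) w p (a : T -> R) : 0 <= w -> (1 <= p)%E ->
  Lpnorm w p a = w `^ fine (p^-1)%E * Lpnorm 1 p a.
Proof.
move=> w0; case: p => [r||] //=.
  rewrite lee_fin => r1; have r0 : 0 < r by rewrite (lt_le_trans _ r1).
  rewrite fine_invr mul1r powRM// sumr_ge0// => x _; exact: powR_ge0.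
by rewrite powRr0 mul1r.
Qed.

(** A relation, symmetric by construction, that keeps the three
    regimes of a pair of dual exponents apart for case analysis. *)
Variant dual_exponents : \bar R -> \bar R -> Prop :=
| Dual_1y : dual_exponents 1%E +oo%E
| Dual_y1 : dual_exponents +oo%E 1%E
| Dual_fin r s : 0 < r -> 0 < s -> r^-1 + s^-1 = 1 ->
    dual_exponents r%:E s%:E.

Lemma dual_exponents_sym p q : dual_exponents p q -> dual_exponents q p.
Proof. by case=> *; constructor => //; rewrite addrC. Qed.

Lemma hoelder_conjugate_dual p : (1 <= p)%E ->
  dual_exponents p (hoelder_conjugate p).
Proof.
case: p => [r||] //; last by move=> _; rewrite hoelder_conjugatey; constructor.
rewrite le_eqVlt => /predU1P[<-|r1].
  by rewrite hoelder_conjugate1; constructor.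
rewrite lte_fin in r1; have r0 : 0 < r by rewrite (lt_trans _ r1).
have r10 : 0 < r - 1 by rewrite subr_gt0.
rewrite /hoelder_conjugate/= eqe gt_eqF//= -EFinD inver gt_eqF//= -EFinM.
constructor => //; first by rewrite divr_gt0.
by rewrite invf_div mulrBl mul1r divff ?gt_eqF// subrKC.
Qed.

Lemma dual_exponents_ge1 p q : dual_exponents p q -> (1 <= p)%E.
Proof.
case=> [||r s r0 s0 rs]; rewrite ?lexx ?leey// lee_fin.
by rewrite -[r]invrK invr_ge1 ?unitfE ?invr_gt0 ?invr_eq0 ?gt_eqF//;
  rewrite -rs lerDl invr_ge0 ltW.
Qed.

Lemma Lpnorm1 (T : finType) w (a : T -> R) : 0 <= w ->
  Lpnorm w 1%E a = w * \sum_x `|a x|.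
Proof.
move=> w0 /=; rewrite invr1 powRr1; last first.
  by rewrite mulr_ge0// sumr_ge0// => x _; exact: powR_ge0.
by under eq_bigr do rewrite powRr1//.
Qed.

Lemma Lpnorm_powR (T : finType) w r (a : T -> R) : 0 <= w -> 0 < r ->
  Lpnorm w r%:E a `^ r = w * \sum_x `|a x| `^ r.
Proof.
move=> w0 r0 /=; rewrite -powRrM mulVf ?gt_eqF// powRr1//.
by rewrite mulr_ge0// sumr_ge0// => x _; exact: powR_ge0.
Qed.

Lemma Lpnorm_eq0 (T : finType) w p (a : T -> R) : 0 < w -> (1 <= p)%E ->
  Lpnorm w p a = 0 -> forall x, a x = 0.
Proof.
move=> w0; case: p => [r||] //; last first.
  move=> _ /= h x; apply/eqP; rewrite -normr_le0 -h; exact: le_bigmax.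
rewrite lee_fin => r1 h x; have r0 : 0 < r by rewrite (lt_le_trans _ r1).
have := Lpnorm_powR a (ltW w0) r0; rewrite h powR0 ?gt_eqF// => /esym/eqP.
rewrite mulf_eq0 gt_eqF//= psumr_eq0; last by move=> ? _; exact: powR_ge0.
by move=> /allP/(_ x (mem_index_enum _))/eqP/powR_eq0_eq0/normr0_eq0.
Qed.

(** Young's inequality, applied pointwise after both norms have been scaled to
    1. The endpoint pair is a supremum bound. *)
Lemma Lpnorm_hoelder (T : finType) w p q (a b : T -> R) :
  0 < w -> dual_exponents p q ->
  w * \sum_x `|a x| * `|b x| <= Lpnorm w p a * Lpnorm w q b.
Proof.
move=> w0 pq.
wlog : p q a b pq / p = +oo%E \/ exists r, p = r%:E /\ exists s, q = s%:E.
  move=> H; case: (pq) => [||r s r0 s0 rs].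
  - rewrite [leRHS]mulrC; under eq_bigr do rewrite mulrC.
    by apply: H; [constructor|left].
  - by apply: H; [constructor|left].
  - by apply: H; [constructor|right; exists r; split => //; exists s].
case: pq => [[//|[? [_ [? //]]]]|_|r s r0 s0 rs _].
- rewrite Lpnorm1 ?(ltW w0)// mulrCA ler_wpM2l ?(ltW w0)// mulr_sumr.
  apply: ler_sum => x _; rewrite ler_wpM2r//.
  exact: (le_bigmax _ (fun x => `|a x|)).
have r1 := dual_exponents_ge1 (Dual_fin r0 s0 rs).
have s1 := dual_exponents_ge1 (dual_exponents_sym (Dual_fin r0 s0 rs)).
(* only the values of the two norms matter from here on *)
have [A AE] : exists A, A = Lpnorm w r%:E a by exact: (ex_intro _ _ erefl).
have [B BE] : exists B, B = Lpnorm w s%:E b by exact: (ex_intro _ _ erefl).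
have A_ge0 : 0 <= A by rewrite AE; exact: Lpnorm_ge0.
have B_ge0 : 0 <= B by rewrite BE; exact: Lpnorm_ge0.
rewrite -AE -BE.
have [A0|A0] := eqVneq A 0.
  rewrite big1 => [|x _]; first by rewrite mulr0 mulr_ge0.
  by rewrite (Lpnorm_eq0 w0 r1 (etrans (esym AE) A0)) normr0 mul0r.
have [B0|B0] := eqVneq B 0.
  rewrite big1 => [|x _]; first by rewrite mulr0 mulr_ge0.
  by rewrite (Lpnorm_eq0 w0 s1 (etrans (esym BE) B0)) normr0 mulr0.
have {}A0 : 0 < A by rewrite lt_def A0.
have {}B0 : 0 < B by rewrite lt_def B0.
rewrite -[leRHS]mulr1 -(ler_pdivrMl _ _ (mulr_gt0 A0 B0)) mulrCA.
have -> : (A * B)^-1 * \sum_x `|a x| * `|b x| =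
    \sum_x (`|a x| / A) * (`|b x| / B).
  by rewrite mulr_sumr; apply: eq_bigr => x _; rewrite invfM mulrC mulrACA.
have -> : 1 = w * \sum_x ((`|a x| / A) `^ r / r + (`|b x| / B) `^ s / s) :> R.
  rewrite big_split/= -!mulr_suml mulrDr !mulrA.
  have unit_mass : forall t (C : R) (u : T -> R), 0 < C -> 0 < t ->
     C = Lpnorm w t%:E u -> w * \sum_x (`|u x| / C) `^ t = 1.
    move=> t C u C0 t0 hC.
    under eq_bigr do rewrite powRM ?normr_ge0 ?invr_ge0 ?(ltW C0)//.
    rewrite -mulr_suml mulrA -Lpnorm_powR ?(ltW w0)// -hC.
    rewrite -powRM ?invr_ge0 ?(ltW C0)//.
    by rewrite divff ?gt_eqF// powR1.
  by rewrite (unit_mass r A a A0 r0 AE) (unit_mass s B b B0 s0 BE) !mul1r rs.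
rewrite ler_wpM2l ?(ltW w0)// ler_sum// => x _.
by apply: conjugate_powR; rewrite ?divr_ge0// ltW.
Qed.

(** The extremizer in Hoelder's inequality is h^(p-1), suitably scaled, for
    1 < p < +oo, the constant 1 for p = 1, and a point mass where h is maximal
    for p = +oo. *)
Lemma Lpnorm_dual (T : finType) w p q (h : T -> R) :
  0 < w -> dual_exponents p q -> (forall x, 0 <= h x) ->
  exists f : T -> R, [/\ forall x, 0 <= f x, Lpnorm w q f <= 1
    & w * \sum_x f x * h x = Lpnorm w p h].
Proof.
move=> w0 pq h0; have p1 := dual_exponents_ge1 pq.
have q1 := dual_exponents_ge1 (dual_exponents_sym pq).
have [A0|A0] := eqVneq (Lpnorm w p h) 0.
  exists (fun=> 0); split => //; last first.
    by rewrite big1 ?mulr0// => x _; rewrite mul0r.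
  rewrite (_ : (fun=> 0) = (fun x : T => 0 * 0)).
    by rewrite LpnormZ ?(ltW w0)// normr0 mul0r.
  by apply/funext => x; rewrite mulr0.
have {}A0 : 0 < Lpnorm w p h by rewrite lt_def A0 Lpnorm_ge0.
case: pq p1 q1 A0 => [||r s r0 s0 rs] p1 q1 A0.
- exists (fun=> 1); split => //.
    by apply/bigmax_leP; split => // x _; rewrite normr1.
  rewrite Lpnorm1 ?(ltW w0)//; congr (_ * _); apply: eq_bigr => x _.
  by rewrite mul1r ger0_norm.
- have [x0 hx0] : exists x0, Lpnorm w +oo%E h = h x0.
    have [x0 _|T0] := pickP (@predT T); last first.
      by move: A0; rewrite /= big_pred0 ?ltxx.
    have [x1 _ h1] := @eq_bigmax _ _ T 0 x0 predT (fun x => `|h x|) isT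
      (fun x _ => normr_ge0 (h x)).
    by exists x1; rewrite /= h1 ger0_norm.
  exists (fun x => (x == x0)%:R / w); split.
  + by move=> x; rewrite divr_ge0 ?(ltW w0).
  + rewrite Lpnorm1 ?(ltW w0)// (bigD1 x0)//= eqxx mul1r big1 => [|x /negPf ->].
      by rewrite addr0 ger0_norm ?invr_ge0 ?(ltW w0)// divff ?gt_eqF.
    by rewrite mul0r normr0.
  + rewrite hx0 (bigD1 x0)//= eqxx mul1r big1 => [|x /negPf ->].
      by rewrite addr0 mulrA divff ?gt_eqF// mul1r.
    by rewrite !mul0r.
set A := Lpnorm w r%:E h in A0 *.
have hA : w * \sum_x h x `^ r = A `^ r.
  rewrite Lpnorm_powR ?(ltW w0)//; congr (_ * _).
  by apply: eq_bigr => x _; rewrite ger0_norm.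
exists (fun x => (h x / A) `^ (r - 1)); split.
- by move=> x; exact: powR_ge0.
- rewrite [leLHS](_ : _ = 1)//=.
  rewrite (_ : _ * _ = 1) ?powR1//.
  under eq_bigr => x _.
    rewrite ger0_norm ?powR_ge0// -powRrM.
    have -> : (r - 1) * s = r.
      have : (r^-1 + s^-1) * (r * s) = r * s by rewrite rs mul1r.
      rewrite mulrDl mulKf ?gt_eqF// mulrCA mulVf ?gt_eqF// mulr1 => H.
      by rewrite mulrBl mul1r -H addrC addKr.
    rewrite powRM ?invr_ge0 ?(ltW A0)//; over.
  rewrite -mulr_suml mulrA hA -powRM ?invr_ge0 ?(ltW A0)//.
  by rewrite divff ?gt_eqF// powR1.
- under eq_bigr => x _.
    rewrite powRM ?invr_ge0 ?(ltW A0)// mulrAC [X in X * _]mulrC mulr_powRB1//.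
    over.
  rewrite -mulr_suml mulrA hA -(mulr_powRB1 (ltW A0) r0) -mulrA.
  by rewrite -powRM ?invr_ge0 ?(ltW A0)// divff ?gt_eqF// powR1 mulr1.
Qed.

(** Hoelder's inequality against the constant 1, which has norm 1 in every
    exponent under a probability measure. *)
Lemma mean_le_Lpnorm (T : finType) w p (a : T -> R) :
  w * #|T|%:R = 1 -> (1 <= p)%E -> w * \sum_x `|a x| <= Lpnorm w p a.
Proof.
move=> wT p1; have w0 : 0 < w.
  have : 0 < w * #|T|%:R by rewrite wT.
  by move=> h; rewrite -(pmulr_lgt0 _ (_ : 0 < #|T|%:R))// lt_def ler0n andbT;
    apply: contraTneq h => ->; rewrite mulr0 ltxx.
have pq := hoelder_conjugate_dual p1.
have := Lpnorm_hoelder a (fun=> 1) w0 pq.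
rewrite Lpnorm_const// ?normr1 ?mulr1; last first.
  exact: dual_exponents_ge1 (dual_exponents_sym pq).
by under eq_bigr do rewrite mulr1.
Qed.

Lemma norm_le_Lpnorm (T : finType) p (a : T -> R) x : (1 <= p)%E ->
  `|a x| <= Lpnorm 1 p a.
Proof.
case: p => [r||] //; last by move=> _; exact: (le_bigmax _ (fun x => `|a x|)).
rewrite lee_fin => r1; have r0 : 0 < r by rewrite (lt_le_trans _ r1).
have -> : `|a x| = (`|a x| `^ r) `^ r^-1.
  by rewrite -powRrM divff ?gt_eqF// powRr1.
rewrite /= mul1r.
apply: ge0_ler_powR; rewrite ?invr_ge0 ?(ltW r0) ?nnegrE ?powR_ge0//.
  by rewrite sumr_ge0// => y _; exact: powR_ge0.
by rewrite (bigD1 x)//= lerDl sumr_ge0// => y _; exact: powR_ge0.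
Qed.

Lemma Lpnorm_fst (T U : finType) p (a : T -> R) : (0 < #|U|)%N -> (1 <= p)%E ->
  Lpnorm (#|{: T * U}|%:R)^-1 p (fun z : T * U => a z.1) =
  Lpnorm (#|T|%:R)^-1 p a.
Proof.
move=> U0 p1; rewrite card_prod natrM invfM Lpnorm_prod ?invr_ge0//.
rewrite -[in RHS]Lpnorm_abs; apply: eq_Lpnorm => x /=.
by rewrite Lpnorm_const// mulVf// pnatr_eq0 -lt0n.
Qed.

End Norms.

(** * Optimal constants *)

Section SmallestConstant.
Context {R : realType} {G : Type} {A B : G -> R}.
Hypotheses (A_ge0 : forall g, 0 <= A g) (B_ge0 : forall g, 0 <= B g).

Lemma smallest_constant_lbound : (exists g, 0 < B g) ->
  lbound [set C | forall g, A g <= C * B g]%classic 0.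
Proof.
move=> [g Bg] C /(_ g) AC.
by rewrite -(pmulr_lge0 _ Bg) (le_trans _ AC).
Qed.

Lemma smallest_constant_ge0 : (exists g, 0 < B g) -> 0 <= smallest_constant A B.
Proof.
move=> /smallest_constant_lbound lb.
have [n0|n0] := pselect ([set C | forall g, A g <= C * B g] !=set0)%classic.
  exact: lb_le_inf.
by rewrite /smallest_constant inf_out// => -[].
Qed.

Lemma smallest_constant_le C : (exists g, 0 < B g) ->
  (forall g, A g <= C * B g) -> smallest_constant A B <= C.
Proof.
by move=> /smallest_constant_lbound lb CP; apply: ge_inf => //; exists 0.
Qed.

(** As soon as some constant works, the infimum works too: where B g > 0 it is
    bounded below by A g / B g, and where B g = 0 any working constant gives
    A g = 0. *)
Lemma smallest_constantP : (exists C, forall g, A g <= C * B g) ->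
  forall g, A g <= smallest_constant A B * B g.
Proof.
move=> [C CP] g; have [Bg|Bg] := eqVneq (B g) 0.
  by rewrite Bg mulr0 -(mulr0 C) -Bg.
have {}Bg : 0 < B g by rewrite lt_def Bg B_ge0.
rewrite -ler_pdivrMr//; apply: lb_le_inf; first by exists C.
by move=> D /(_ g); rewrite ler_pdivrMr.
Qed.

End SmallestConstant.

Section ComplexModulus.
Context {R : realType}.
Implicit Types z : R[i].

Lemma normc_ge0 z : 0 <= normc z.
Proof. by case: z => a b; exact: sqrtr_ge0. Qed.

Lemma normc_sum (I : finType) (z : I -> R[i]) :
  normc (\sum_i z i) <= \sum_i normc (z i).
Proof.
elim/big_ind2: _ => [|x a y b xa yb|//]; first by rewrite normc0.
by rewrite (le_trans (le_normcD _ _))// lerD.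
Qed.

Lemma normc_real (a : R) : normc a%:C = `|a|.
Proof. by rewrite /= expr0n addr0 sqrtr_sqr. Qed.

Lemma normc_nat k : normc (k%:R : R[i]) = k%:R.
Proof. by rewrite -(rmorph_nat (@real_complex R)) normc_real normr_nat. Qed.

Lemma sqr_normcE z : (normc z ^+ 2)%:C = z * z^*%C.
Proof. by rewrite -sqr_normc normc_def -rmorphXn; case: z. Qed.

End ComplexModulus.

(** Finiteness of the constants: a family that is bounded pointwise in terms of
    the sup norm of b g is bounded in any pair of exponents, since all
    norms on a finite type are comparable. *)
Lemma Lpnorm_bounded (R : realType) (G : Type) (T U : finType) (w w' : R)
    (p q : \bar R) (a : G -> T -> R) (b : G -> U -> R) (k : R) :
  0 <= w -> 0 < w' -> (1 <= p)%E -> (1 <= q)%E -> 0 <= k ->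
  (forall g M, 0 <= M -> (forall y, `|b g y| <= M) ->
     forall x, `|a g x| <= k * M) ->
  exists C, forall g, Lpnorm w q (a g) <= C * Lpnorm w' p (b g).
Proof.
move=> w0 w'0 p1 q1 k0 H; pose D : R := (w' `^ fine (p^-1)%E)^-1.
have D0 : 0 <= D by rewrite invr_ge0 powR_ge0.
have DP g y : `|b g y| <= D * Lpnorm w' p (b g).
  rewrite Lpnorm_weight ?(ltW w'0)// mulKf ?gt_eqF ?powR_gt0//.
  exact: norm_le_Lpnorm.
exists (k * D * Lpnorm w q (fun _ : T => 1)) => g.
rewrite mulrAC -ge0_LpnormZ ?mulr_ge0 ?Lpnorm_ge0//.
apply: le_Lpnorm => // x; rewrite mulr1 [leRHS]ger0_norm; last first.
  by rewrite !mulr_ge0 ?Lpnorm_ge0.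
by rewrite -mulrA; apply: H; rewrite ?mulr_ge0 ?Lpnorm_ge0.
Qed.

(** * Restriction and Kakeya constants *)

Section ParametrizedRestriction.
Context {R : realType} {F : finFieldType}.
Variables (e : F -> R[i]) (m : nat) (T : finType) (phi : T -> 'rV[F]_m).

(** Both paraboloids are graphs; integrating over their parameters
    replaces functions on a subset of F^m by functions on F^(n-1) or on
    F^(n-1) * F^(n-1). *)
Definition param_extension (g : T -> R[i]) (x : 'rV[F]_m) : R[i] :=
  (#|T|%:R)^-1 * \sum_t g t * e (dotp x (phi t)).

Hypothesis e_circle : forall x, normc (e x) = 1.
Hypothesis phi_inj : injective phi.
Variable S : {set 'rV[F]_m}.
Hypothesis SE : S = phi @: [set: T].
Hypothesis T_gt0 : (0 < #|T|)%N.

Lemma card_param : #|S| = #|T|.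
Proof. by rewrite SE card_imset// cardsT. Qed.

Lemma card_paramV : (#|S|%:R)^-1 * #|{: {xi | xi \in S}}|%:R = 1 :> R.
Proof. by rewrite card_sig mulVf// pnatr_eq0 -lt0n card_param. Qed.

Lemma param_mem t : phi t \in S.
Proof. by rewrite SE imset_f. Qed.

Definition param_point t : {xi | xi \in S} := exist _ (phi t) (param_mem t).

Lemma param_point_bij : bijective param_point.
Proof.
apply: inj_card_bij; last by rewrite card_sig card_param.
by move=> t u /(congr1 val)/phi_inj.
Qed.

Lemma extension_param g x :
  extension e g x = param_extension (fun t => g (param_point t)) x.
Proof.
rewrite /extension /param_extension card_param (reindex param_point)//=.
exact/onW_bij/param_point_bij.
Qed.

Section Exponents.
Variables p q : \bar R.
Hypotheses (p1 : (1 <= p)%E) (q1 : (1 <= q)%E).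

Lemma Lpnorm_param (g : {xi | xi \in S} -> R[i]) :
  Lpnorm (#|S|%:R)^-1 p (fun xi => normc (g xi)) =
  Lpnorm (#|T|%:R)^-1 p (fun t => normc (g (param_point t))).
Proof. by rewrite card_param -(Lpnorm_reindex _ _ _ param_point_bij). Qed.

Lemma restriction_test : exists g : {xi | xi \in S} -> R[i],
  0 < Lpnorm (#|S|%:R)^-1 p (fun xi => normc (g xi)).
Proof.
exists (fun=> 1); rewrite Lpnorm_const// ?card_paramV//.
by rewrite normc1 normr1.
Qed.

Lemma restriction_constant_ge0 : 0 <= restriction_constant e S p q.
Proof.
apply: smallest_constant_ge0; last exact: restriction_test.
by move=> g; exact: Lpnorm_ge0.
Qed.

Lemma restriction_constant_le C :
  (forall g : T -> R[i],
     Lpnorm 1 q (fun x => normc (param_extension g x)) <=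
     C * Lpnorm (#|T|%:R)^-1 p (fun t => normc (g t))) ->
  restriction_constant e S p q <= C.
Proof.
move=> H; apply: smallest_constant_le; last 2 first.
- exact: restriction_test.
- move=> g; rewrite Lpnorm_param; apply: le_trans (H _).
  by rewrite (eq_Lpnorm _ _ (fun x => congr1 (@normc R) (extension_param g x))).
by move=> g; exact: Lpnorm_ge0.
Qed.

Lemma restriction_constantP (g : T -> R[i]) :
  Lpnorm 1 q (fun x => normc (param_extension g x)) <=
  restriction_constant e S p q * Lpnorm (#|T|%:R)^-1 p (fun t => normc (g t)).
Proof.
have [h hK _] := param_point_bij.
pose g' xi := g (h xi).
have gK t : g' (param_point t) = g t by rewrite /g' hK.
have -> : Lpnorm (#|T|%:R)^-1 p (fun t => normc (g t)) =
    Lpnorm (#|S|%:R)^-1 p (fun xi => normc (g' xi)).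
  by rewrite Lpnorm_param; apply: eq_Lpnorm => t; rewrite gK.
have -> : (fun x => normc (param_extension g x)) =
    fun x => normc (extension e g' x).
  by apply/funext => x; rewrite extension_param (funext gK).
move: g' {gK}; apply: smallest_constantP.
  by move=> ?; exact: Lpnorm_ge0.
apply: (@Lpnorm_bounded _ _ _ _ _ _ _ _ _ _ 1) => //.
  by rewrite invr_gt0 ltr0n card_param.
move=> f M M0 fM x; rewrite mul1r ger0_norm ?normc_ge0//.
rewrite /extension normcM normcV normc_nat ler_pdivrMl; last first.
  by rewrite ltr0n card_param.
apply: (le_trans (normc_sum _)).
apply: (@le_trans _ _ (\sum_(xi : {xi | xi \in S}) M)).
  apply: ler_sum => xi _; rewrite normcM e_circle mulr1.
  by rewrite -[leLHS]ger0_norm ?normc_ge0.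
by rewrite sumr_const card_sig [leRHS]mulr_natl.
Qed.

End Exponents.
End ParametrizedRestriction.

Section KakeyaConstant.
Context {R : realType} {F : finFieldType}.
Variables (d : nat) (p q : \bar R).
Hypotheses (p1 : (1 <= p)%E) (q1 : (1 <= q)%E).

Lemma card_rV_gt0 : (0 < #|{: 'rV[F]_d}|)%N.
Proof. by apply/card_gt0P; exists 0. Qed.

Lemma card_rVV : (#|{: 'rV[F]_d}|%:R)^-1 * #|{: 'rV[F]_d}|%:R = 1 :> R.
Proof. by rewrite mulVf// pnatr_eq0 -lt0n card_rV_gt0. Qed.

Lemma kakeya_test : exists f : 'rV[F]_(d + 1) -> R[i],
  0 < Lpnorm 1 p (fun x => normc (f x)).
Proof.
exists (fun=> 1); rewrite lt_def Lpnorm_ge0 andbT; apply/eqP.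
move/(Lpnorm_eq0 ltr01 p1)/(_ 0)/eqP.
by rewrite normc1 oner_eq0.
Qed.

Lemma kakeya_constant_ge0 : 0 <= kakeya_constant F d p q.
Proof.
apply: smallest_constant_ge0; last exact: kakeya_test.
by move=> f; exact: Lpnorm_ge0.
Qed.

Lemma kakeya_constant_le C :
  (forall f : 'rV[F]_(d + 1) -> R[i],
     Lpnorm (#|{: 'rV[F]_d}|%:R)^-1 q (kakeya_maximal f) <=
     C * Lpnorm 1 p (fun x => normc (f x))) ->
  kakeya_constant F d p q <= C.
Proof.
move=> H; apply: smallest_constant_le => //; last exact: kakeya_test.
by move=> f; exact: Lpnorm_ge0.
Qed.

Lemma kakeya_constantP (f : 'rV[F]_(d + 1) -> R[i]) :
  Lpnorm (#|{: 'rV[F]_d}|%:R)^-1 q (kakeya_maximal f) <=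
  kakeya_constant F d p q * Lpnorm 1 p (fun x => normc (f x)).
Proof.
move: f; apply: smallest_constantP; first by move=> f; exact: Lpnorm_ge0.
apply: (@Lpnorm_bounded _ _ _ _ _ _ _ _ _ _ #|{: 'rV[F]_(d + 1)}|%:R) => //.
move=> f M M0 fM v; rewrite ger0_norm ?bigmax_ge_id//.
apply/bigmax_leP; split=> [|x0 _]; first by rewrite mulr_ge0.
rewrite big_mkcond mulr_natl -sumr_const; apply: ler_sum => x _.
by case: ifP => // _; rewrite -[leLHS]ger0_norm ?normc_ge0.
Qed.

End KakeyaConstant.

(** * Fourier analysis on finite vector spaces *)

Section DotProduct.
Context {F : finFieldType} {m : nat}.
Implicit Types x y z : 'rV[F]_m.

Lemma dotpC x y : dotp x y = dotp y x.
Proof. by apply: eq_bigr => i _; rewrite mulrC. Qed.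

Lemma dotpDl x y z : dotp (x + y) z = dotp x z + dotp y z.
Proof. by rewrite /dotp -big_split; apply: eq_bigr => i _; rewrite mxE mulrDl. Qed.

Lemma dotpDr x y z : dotp x (y + z) = dotp x y + dotp x z.
Proof. by rewrite dotpC dotpDl !(dotpC x). Qed.

Lemma dotpZl t x z : dotp (t *: x) z = t * dotp x z.
Proof. by rewrite /dotp mulr_sumr; apply: eq_bigr => i _; rewrite mxE mulrA. Qed.

Lemma dotpNr x y : dotp x (- y) = - dotp x y.
Proof. by rewrite /dotp -sumrN; apply: eq_bigr => i _; rewrite mxE mulrN. Qed.

Lemma dotp0 x : dotp x 0 = 0.
Proof. by apply: big1 => i _; rewrite mxE mulr0. Qed.

Lemma dotp_delta k i x : dotp (k *: delta_mx 0 i) x = k * x 0 i.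
Proof.
rewrite dotpZl; congr (_ * _); rewrite /dotp (bigD1 i)//= mxE !eqxx mul1r.
by rewrite big1 ?addr0// => j /negPf ji; rewrite mxE ji andbF mul0r.
Qed.

End DotProduct.

Lemma dotp_row_mx (F : finFieldType) m k (x y : 'rV[F]_m) (u v : 'rV[F]_k) :
  dotp (row_mx x u) (row_mx y v) = dotp x y + dotp u v.
Proof.
rewrite /dotp big_split_ord/=; congr (_ + _); apply: eq_bigr => i _.
  by rewrite !row_mxEl.
by rewrite !row_mxEr.
Qed.

Section AdditiveCharacter.
Context {R : realType} {F : finFieldType}.
Variable e : F -> R[i].
Hypothesis e_circle : forall x, normc (e x) = 1.
Hypothesis eD : forall x y, e (x + y) = e x * e y.
Hypothesis e_nonprincipal : ~ (forall x, e x = 1).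

Lemma char_neq0 x : e x != 0.
Proof.
apply/eqP => /(congr1 (@normc R)); rewrite e_circle normc0 => /eqP.
by rewrite oner_eq0.
Qed.

Lemma char0 : e 0 = 1.
Proof. by apply: (mulfI (char_neq0 0)); rewrite -eD addr0 mulr1. Qed.

Lemma charN x : e (- x) = (e x)^*%C.
Proof.
apply: (mulfI (char_neq0 x)); rewrite -eD subrr char0 -sqr_normcE e_circle.
by rewrite expr1n.
Qed.

(** If z <> 0, some translation x |-> x + x0 multiplies the summand by a value
    e a <> 1, so the sum vanishes. *)
Lemma char_sum m (z : 'rV[F]_m) :
  \sum_x e (dotp x z) = if z == 0 then #|{: 'rV[F]_m}|%:R else 0.
Proof.
case: eqVneq => [->|z0].
  by under eq_bigr do rewrite dotp0 char0; rewrite sumr_const.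
have [i zi] : exists i, z 0 i != 0.
  apply/existsP; apply: contraNT z0 => /existsPn zi; apply/eqP/rowP => i.
  by have /negPn/eqP := zi i; rewrite mxE.
have [a ea] : exists a, e a != 1.
  apply: contra_notP e_nonprincipal => /forallNP h x.
  by have /negP/negPn/eqP := h x.
(* a multiple of a basis vector whose dot product with z is a *)
pose x0 := (a / z 0 i) *: delta_mx 0 i : 'rV[F]_m.
have x0z : dotp x0 z = a by rewrite dotp_delta divfK.
(* translation by x0 shows that the sum is fixed by multiplication by e a *)
apply/eqP; rewrite -(mulrI_eq0 _ (_ : GRing.lreg (e a - 1))); last first.
  by apply/lregP; rewrite subr_eq0.
rewrite mulrBl mul1r subr_eq0 mulr_sumr; apply/eqP.
rewrite [RHS](reindex_inj (addIr x0)); apply: eq_bigr => x _.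
by rewrite dotpDl x0z eD mulrC.
Qed.

(** Expanding the square produces the characters of z - z', whose sums over x
    vanish off the diagonal. *)
Lemma parseval m (b : 'rV[F]_m -> R[i]) :
  \sum_x normc (\sum_z b z * e (dotp x z)) ^+ 2 =
  #|{: 'rV[F]_m}|%:R * \sum_z normc (b z) ^+ 2.
Proof.
apply: (@complexI R).
rewrite rmorphM rmorph_nat !rmorph_sum.
under eq_bigr => x _.
  rewrite /= sqr_normcE rmorph_sum big_distrlr/=.
  under eq_bigr => z _.
    under eq_bigr => z' _.
      rewrite rmorphM/= -charN mulrACA -eD -dotpNr -dotpDr; over.
    over.
  over.
rewrite exchange_big mulr_sumr; apply: eq_bigr => z _.
rewrite exchange_big (bigD1 z)//= [X in _ + X]big1 ?addr0 => [|z' z'z].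
  by rewrite -mulr_sumr char_sum subrr eqxx sqr_normcE mulrC.
by rewrite -mulr_sumr char_sum subr_eq0 [z == _]eq_sym (negPf z'z) mulr0.
Qed.

End AdditiveCharacter.

(** * Lines and paraboloids in coordinates *)

Section Points.
Context {F : finFieldType} {d : nat}.

(** Lines of the Kakeya problem are never horizontal: the last coordinate t
    parametrizes them, and plays the role of time. *)
Definition spacetime (x : 'rV[F]_d) (t : F) : 'rV[F]_(d + 1) :=
  row_mx x (const_mx t).

Lemma dotp_spacetime x t y s :
  dotp (spacetime x t) (spacetime y s) = dotp x y + t * s.
Proof.
by rewrite dotp_row_mx; congr (_ + _); rewrite /dotp big_ord1 !mxE.
Qed.

Lemma spacetime_bij : bijective (fun z : 'rV[F]_d * F => spacetime z.1 z.2).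
Proof.
exists (fun u => (lsubmx u, rsubmx u 0 0)) => [[x t]|u]/=.
  by rewrite row_mxKl row_mxKr mxE.
rewrite /spacetime -[RHS]hsubmxK; congr row_mx; apply/rowP => i.
by rewrite (ord1 i) [LHS]mxE.
Qed.

(** The blocks are swapped because the second one, the slice variable, is the
    outer variable of the iterated norms. *)
Lemma row_mx_bij m :
  bijective (fun z : 'rV[F]_m * 'rV[F]_m => row_mx z.2 z.1).
Proof.
exists (fun u => (rsubmx u, lsubmx u)) => [[x y]|u]/=.
  by rewrite row_mxKl row_mxKr.
by rewrite hsubmxK.
Qed.

Definition paraboloid_point (xi : 'rV[F]_d) := spacetime xi (dotp xi xi).

Definition tilde_paraboloid_point (z : 'rV[F]_d * 'rV[F]_d) :=
  row_mx (paraboloid_point z.1) (spacetime z.2 (dotp z.1 z.2)).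

Lemma paraboloid_point_inj : injective paraboloid_point.
Proof. by move=> x y /eq_row_mx[]. Qed.

Lemma tilde_paraboloid_point_inj : injective tilde_paraboloid_point.
Proof.
move=> [x y] [x' y'] /eq_row_mx[/paraboloid_point_inj/= -> /eq_row_mx[->]].
by [].
Qed.

Lemma paraboloidE : paraboloid F d = paraboloid_point @: [set: 'rV[F]_d].
Proof.
by apply/setP => u; apply/imsetP/imsetP => -[x _ ->]; exists x.
Qed.

Lemma tilde_paraboloidE :
  tilde_paraboloid F d = tilde_paraboloid_point @: [set: 'rV[F]_d * 'rV[F]_d].
Proof.
apply/setP => u; apply/imset2P/imsetP.
  by move=> [x y _ _ ->]; exists (x, y).
by move=> [[x y] _ ->]; exists x y.
Qed.

Lemma sum_over_line (R : realType) (x0 v : 'rV[F]_d) (f : 'rV[F]_(d + 1) -> R) :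
  \sum_(u in line x0 v) f u = \sum_t f (spacetime (x0 + t *: v) t).
Proof.
rewrite /line big_imset//= => t t' _ _ /eq_row_mx[_ /rowP/(_ 0)].
by rewrite !mxE.
Qed.

End Points.

(** * Comparison of the constants *)

Section RestrictionKakeya.
Context {R : realType} {F : finFieldType} {d : nat}.
Variable e : F -> R[i].
Hypothesis e_circle : forall x, normc (e x) = 1.
Hypothesis eD : forall x y, e (x + y) = e x * e y.
Hypothesis e_nonprincipal : ~ (forall x, e x = 1).

Local Notation V := 'rV[F]_d.
Local Notation N := (#|{: 'rV[F]_d}|%:R : R).
Local Notation extS := (param_extension e (@paraboloid_point F d)).
Local Notation extT := (param_extension e (@tilde_paraboloid_point F d)).

Definition partial_fourier (G : V * V -> R[i]) (xi z : V) : R[i] :=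
  (#|{: V}|%:R)^-1 * \sum_eta G (xi, eta) * e (dotp z eta).

Lemma natr_card_rV_gt0 : 0 < N.
Proof. by rewrite ltr0n card_rV_gt0. Qed.

Lemma natr_card_rV_sqrVM : N^-1 ^+ 2 * N = N^-1.
Proof. by rewrite expr2 -mulrA mulVf ?mulr1// gt_eqF ?natr_card_rV_gt0. Qed.

(** The phase of the tilde paraboloid is (x.xi + t xi.xi) + (y + s xi).eta with
    u = (x, t): the second summand is the only one that contains eta, and
    eta enters it linearly. *)
Lemma tilde_extension G (u : 'rV[F]_(d + 1)) (y : V) s :
  extT G (row_mx u (spacetime y s)) =
  extS (fun xi : V => partial_fourier G xi (y + s *: xi)) u.
Proof.
rewrite /param_extension card_prod natrM invfM -mulrA; congr (_ * _).
transitivity ((#|{: V}|%:R)^-1 * \sum_xi \sum_eta G (xi, eta) *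
    e (dotp (row_mx u (spacetime y s)) (tilde_paraboloid_point (xi, eta)))).
  by rewrite pair_bigA/=; congr (_ * _); apply: eq_bigr => -[].
rewrite mulr_sumr; apply: eq_bigr => xi _.
rewrite /partial_fourier -mulrA mulr_suml; congr (_ * _).
apply: eq_bigr => eta _; rewrite -mulrA -eD; congr (_ * e _).
by rewrite dotp_row_mx dotp_spacetime/= dotpDl dotpZl addrC.
Qed.

Lemma paraboloid_extension_spacetime h x t :
  extS h (spacetime x t) =
  (#|{: V}|%:R)^-1 * \sum_xi (h xi * e (t * dotp xi xi)) * e (dotp x xi).
Proof.
congr (_ * _); apply: eq_bigr => xi _.
by rewrite dotp_spacetime -mulrA -eD addrC.
Qed.

(** For fixed t this is Plancherel in x, the factor e(t xi.xi) having modulus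
    1; the |F| values of t contribute equally. *)
Lemma paraboloid_extension_L2 h :
  \sum_u normc (extS h u) ^+ 2 = #|F|%:R / N * \sum_xi normc (h xi) ^+ 2.
Proof.
rewrite (reindex (fun z : V * F => spacetime z.1 z.2)); last first.
  exact/onW_bij/spacetime_bij.
transitivity (\sum_(t : F) \sum_(x : V) normc (extS h (spacetime x t)) ^+ 2).
  by rewrite exchange_big pair_bigA.
rewrite -mulrA mulr_natl -sumr_const; apply: eq_bigr => t _.
under eq_bigr => x _.
  rewrite paraboloid_extension_spacetime normcM exprMn normcV normc_nat; over.
rewrite -mulr_sumr parseval// mulrA natr_card_rV_sqrVM.
by congr (_ * _); apply: eq_bigr => xi _; rewrite normcM e_circle mulr1.
Qed.

Lemma partial_fourier_L2 G xi :
  \sum_z normc (partial_fourier G xi z) ^+ 2 =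
  N^-1 * \sum_eta normc (G (xi, eta)) ^+ 2.
Proof.
under eq_bigr do rewrite normcM exprMn normcV normc_nat.
by rewrite -mulr_sumr parseval// mulrA natr_card_rV_sqrVM.
Qed.

(** A modulation in eta concentrates the transform at one point: this is how
    data on the tilde paraboloid singles out, for each xi, the (y, s) with
    y + s xi = - phi xi, that is, a line. *)
Lemma partial_fourier_modulated (b : V -> R[i]) (phi : V -> V) xi z :
  partial_fourier (fun w => b w.1 * e (dotp (phi w.1) w.2)) xi z =
  b xi * (z + phi xi == 0)%:R.
Proof.
rewrite /partial_fourier/=.
under eq_bigr do rewrite -mulrA -eD -dotpDl dotpC [phi xi + z]addrC.
rewrite -mulr_sumr char_sum// mulrCA; congr (_ * _).
by case: eqP => _; rewrite ?mulr0// mulVf// pnatr_eq0 -lt0n card_rV_gt0.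
Qed.

Section Exponents.
Variables p q : \bar R.
Hypotheses (p2 : (2%:E <= p)%E) (q2 : (2%:E <= q)%E).
Let p1 := ge2_ge1 p2.
Let q1 := ge2_ge1 q2.
Let P1 := half_ge1 p2.
Let Q1 := half_ge1 q2.
Let conjP := hoelder_conjugate_dual P1.
Let conjQ := hoelder_conjugate_dual Q1.

Local Notation RS := (restriction_constant e (paraboloid F d)).
Local Notation RT := (restriction_constant e (tilde_paraboloid F d) p q).
Local Notation K := (kakeya_constant F d (hoelder_conjugate (q / 2%:E)%E)
  (hoelder_conjugate (p / 2%:E)%E)).

Lemma card_VV_gt0 : (0 < #|{: V * V}|)%N.
Proof. by rewrite card_prod muln_gt0 card_rV_gt0. Qed.

Lemma tilde_restriction_constant_ge0 : 0 <= RT.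
Proof.
apply: (restriction_constant_ge0 _ (@tilde_paraboloid_point_inj F d)) => //.
- exact: tilde_paraboloidE.
- exact: card_VV_gt0.
Qed.

Lemma tilde_restriction_constantP G : Lpnorm 1 q (fun x => normc (extT G x)) <=
  RT * Lpnorm (#|{: V * V}|%:R)^-1 p (fun z => normc (G z)).
Proof.
apply: restriction_constantP => //.
- exact: tilde_paraboloid_point_inj.
- exact: tilde_paraboloidE.
- exact: card_VV_gt0.
Qed.

Lemma Lpnorm_tilde_extension G :
  Lpnorm 1 q (fun x => normc (extT G x)) =
  Lpnorm 1 q (fun w : V * F => Lpnorm 1 q (fun u =>
    normc (extS (fun xi : V => partial_fourier G xi (w.1 + w.2 *: xi)) u))).
Proof.
rewrite -(Lpnorm_reindex _ _ _ (@row_mx_bij F (d + 1)))/=.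
rewrite -{1}(mulr1 (1 : R)) Lpnorm_prod//=.
rewrite -(Lpnorm_reindex _ _ _ (@spacetime_bij F d)); apply: eq_Lpnorm => w.
by apply: eq_Lpnorm => u /=; rewrite tilde_extension.
Qed.

(** The norm over F^(2n) dominates the one over the slice (y, s) = (0, 0). *)
Lemma restriction_le_tilde : RS p q <= RT.
Proof.
apply: (restriction_constant_le (@paraboloid_point_inj F d) paraboloidE _ p1).
  exact: card_rV_gt0.
(* the trivial modulation e (0 . eta) = 1 brings the data in the form of
   [partial_fourier_modulated] with phi = 0 *)
move=> g; pose G (z : V * V) := g z.1 * e (dotp (0 : V) z.2).
have normG z : normc (G z) = normc (g z.1) by rewrite normcM e_circle mulr1.
have <- : Lpnorm (#|{: V * V}|%:R)^-1 p (fun z => normc (G z)) =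
    Lpnorm (#|{: V}|%:R)^-1 p (fun xi => normc (g xi)).
  rewrite (eq_Lpnorm _ _ normG).
  by rewrite (Lpnorm_fst (fun x => normc (g x))) ?card_rV_gt0.
apply: le_trans (tilde_restriction_constantP G); rewrite Lpnorm_tilde_extension.
apply: le_trans (norm_le_Lpnorm _ (0, 0) q1).
rewrite ger0_norm ?Lpnorm_ge0//=.
rewrite (_ : (fun xi => partial_fourier G xi _) = g)//; apply/funext => xi.
by rewrite (partial_fourier_modulated g (fun=> 0)) scale0r !addr0 eqxx mulr1.
Qed.

(** The average over u of the squared slice is computed by
    [paraboloid_extension_L2], and it is at most the L^(q/2) average, hence at
    most the L^q norm squared up to the mass of F^n to the power 2/q. *)
Lemma mean_square_le_tilde G :
  #|{: 'rV[F]_(d + 1)}|%:R `^ fine ((q / 2%:E)^-1)%E / N *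
    Lpnorm 1 (q / 2%:E)%E (fun w : V * F =>
      N^-1 * \sum_xi normc (partial_fourier G xi (w.1 + w.2 *: xi)) ^+ 2) <=
  Lpnorm 1 q (fun x => normc (extT G x)) ^+ 2.
Proof.
rewrite Lpnorm_tilde_extension Lpnorm_sqr// -ge0_LpnormZ//.
have sq_ge0 (h : V -> R[i]) : 0 <= \sum_xi normc (h xi) ^+ 2.
  by rewrite sumr_ge0// => xi _; exact: sqr_ge0.
apply: le_Lpnorm => // w; rewrite Lpnorm_sqr//.
rewrite !ger0_norm ?Lpnorm_ge0 ?mulr_ge0 ?invr_ge0 ?powR_ge0//.
set h := fun xi => partial_fourier _ _ _.
pose W : R := #|{: 'rV[F]_(d + 1)}|%:R.
have W0 : 0 < W by rewrite ltr0n card_rV_gt0.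
have WE : W = N * #|F|%:R.
  by rewrite /W !card_mx !mul1n expnD expn1 natrM.
have := @mean_le_Lpnorm R _ W^-1 _ (fun u => normc (extS h u) ^+ 2)
  (card_rVV _) Q1.
rewrite Lpnorm_weight ?invr_ge0 ?(ltW W0)//.
under eq_bigr do rewrite ger0_norm ?sqr_ge0//.
rewrite paraboloid_extension_L2.
have -> : W^-1 `^ fine ((q / 2%:E)^-1)%E = (W `^ fine ((q / 2%:E)^-1)%E)^-1.
  by rewrite -powR_inv1 ?(ltW W0)// -powRrM mulN1r powRN.
rewrite ler_pdivlMl ?powR_gt0//; apply: le_trans.
rewrite -!mulrA ler_wpM2l ?powR_ge0// WE invfM.
have F0 : 0 < #|F|%:R :> R by rewrite ltr0n; apply/card_gt0P; exists 0.
by rewrite -!mulrA mulKf ?gt_eqF.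
Qed.

Lemma Lpnorm_normc_sqr (T : finType) (w : R) (r : \bar R) (g : T -> R[i])
    (a : T -> R) : (2%:E <= r)%E -> (forall t, normc (g t) ^+ 2 = a t) ->
  Lpnorm w r (fun t => normc (g t)) ^+ 2 = Lpnorm w (r / 2%:E)%E a.
Proof. by move=> r2 ga; rewrite Lpnorm_sqr//; exact: eq_Lpnorm. Qed.

(* |F|^(n-1-2n/q), as [averaging_loss_powR] shows *)
Local Notation loss :=
  (N / #|{: 'rV[F]_(d + 1)}|%:R `^ fine ((q / 2%:E)^-1)%E).

(** The dual form of a Kakeya estimate: one line per direction v, of weight
    a v, and an L^(q/2) bound for the weighted number of lines through a
    point. The test function a(-xi)^(1/2) e(-x0(-xi).eta) puts the wave
    attached to xi on the line chosen for v = - xi; the sign comes from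
    y + s xi = x0(-xi) being a line of direction - xi. *)
Lemma line_overlap_le (a : V -> R) (x0 : V -> V) : (forall v, 0 <= a v) ->
  Lpnorm 1 (q / 2%:E)%E (fun w : V * F =>
    N^-1 * \sum_v a v * (w.1 == x0 v + w.2 *: v)%:R) <=
  RT ^+ 2 * loss * Lpnorm N^-1 (p / 2%:E)%E a.
Proof.
move=> a0; pose b (xi : V) : R[i] := (Num.sqrt (a (- xi)))%:C.
pose phi (xi : V) := - x0 (- xi).
pose G (z : V * V) := b z.1 * e (dotp (phi z.1) z.2).
have normb xi : normc (b xi) ^+ 2 = a (- xi).
  by rewrite normc_real ger0_norm ?sqrtr_ge0// sqr_sqrtr.
have W0 : 0 < #|{: 'rV[F]_(d + 1)}|%:R `^ fine ((q / 2%:E)^-1)%E :> R.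
  by rewrite powR_gt0// ltr0n card_rV_gt0.
rewrite -[leRHS]mulrA [leRHS]mulrCA -ler_pdivrMl ?divr_gt0 ?natr_card_rV_gt0//.
rewrite invf_div.
have -> : Lpnorm N^-1 (p / 2%:E)%E a =
    Lpnorm (#|{: V * V}|%:R)^-1 p (fun z => normc (G z)) ^+ 2.
  rewrite (@Lpnorm_normc_sqr _ _ _ _ (fun z => a (- z.1)))//; last first.
    by move=> z; rewrite normcM e_circle mulr1.
  rewrite (Lpnorm_fst (fun xi => a (- xi))) ?card_rV_gt0//.
  by rewrite (Lpnorm_reindex _ _ a (inv_bij opprK)).
rewrite -exprMn.
apply: le_trans (_ : Lpnorm 1 q (fun x => normc (extT G x)) ^+ 2 <= _).
  apply: le_trans (mean_square_le_tilde G).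
  rewrite le_eqVlt; apply/orP; left; apply/eqP; congr (_ * _).
  apply: eq_Lpnorm => -[y t]/=; congr (_ * _).
  rewrite (reindex_inj oppr_inj); apply: eq_bigr => xi _.
  rewrite partial_fourier_modulated normcM normc_nat exprMn normb.
  congr (_ * _); rewrite /phi scalerN -addrA -subr_eq0 opprB.
  by case: eqP; rewrite ?expr1n ?expr0n.
apply: lerXn2r; rewrite ?nnegrE ?mulr_ge0 ?Lpnorm_ge0//.
  exact: tilde_restriction_constant_ge0.
exact: tilde_restriction_constantP.
Qed.

(** By duality the norm of the maximal function is its pairing with some
    weight a. For lines that attain the maximum, that pairing is also the
    pairing of |f| with the overlap function of the lines weighted by a. *)
Lemma kakeya_le_tilde : K <= RT ^+ 2 * loss.
Proof.
have conjP' := dual_exponents_sym conjP; have conjQ' := dual_exponents_sym conjQ.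
apply: (kakeya_constant_le (dual_exponents_ge1 conjQ')) => f.
have f_ge0 v : 0 <= kakeya_maximal f v by exact: bigmax_ge_id.
have N0 : 0 < N^-1 by rewrite invr_gt0 natr_card_rV_gt0.
have [a [a0 a1 <-]] := Lpnorm_dual N0 conjP' f_ge0.
have /choice[x0 x0P] v : exists x,
    kakeya_maximal f v = \sum_(t : F) normc (f (spacetime (x + t *: v) t)).
  have [x _ xP] := @eq_bigmax _ _ _ 0 (0 : V) predT
    (fun x => \sum_(u in line x v) normc (f u)) isT
    (fun x _ => sumr_ge0 _ (fun u _ => normc_ge0 (f u))).
  by exists x; rewrite /kakeya_maximal xP sum_over_line.
pose A (w : V * F) := N^-1 * \sum_v a v * (w.1 == x0 v + w.2 *: v)%:R.
have A_ge0 w : 0 <= A w.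
  by rewrite mulr_ge0 ?(ltW N0)// sumr_ge0// => v _; rewrite mulr_ge0.
(* interchange the sums over directions and over points of the lines *)
have -> : N^-1 * \sum_v a v * kakeya_maximal f v =
    1 * \sum_w `|normc (f (spacetime w.1 w.2))| * `|A w|.
  rewrite mul1r; under [RHS]eq_bigr => w _.
    rewrite !ger0_norm ?normc_ge0// /A mulrCA mulr_sumr; over.
  rewrite -mulr_sumr exchange_big; congr (_ * _); apply: eq_bigr => v _.
  rewrite x0P mulr_sumr.
  rewrite -(pair_bigA _ (fun y t => normc (f (spacetime y t)) *
    (a v * (y == x0 v + t *: v)%:R)))/= exchange_big; apply: eq_bigr => t _.
  rewrite (bigD1 (x0 v + t *: v))//= eqxx mulr1 mulrC big1 ?addr0// => y /negPf ->.
  by rewrite !mulr0.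
apply: le_trans (Lpnorm_hoelder _ _ ltr01 conjQ') _.
rewrite (Lpnorm_reindex _ _ (fun u => normc (f u)) spacetime_bij) mulrC.
rewrite ler_wpM2r ?Lpnorm_ge0//; apply: le_trans (line_overlap_le x0 a0) _.
by rewrite ler_piMr// mulr_ge0 ?sqr_ge0// divr_ge0 ?powR_ge0.
Qed.

(** Plancherel in eta, then the power mean inequality on each fiber, as
    p / 2 >= 1. *)
Lemma fiber_energy_le G :
  Lpnorm N^-1 (p / 2%:E)%E
    (fun xi => \sum_z normc (partial_fourier G xi z) ^+ 2) <=
  Lpnorm (#|{: V * V}|%:R)^-1 p (fun z => normc (G z)) ^+ 2.
Proof.
rewrite (@Lpnorm_normc_sqr _ _ _ _ (fun z => normc (G z) ^+ 2))//.
rewrite card_prod natrM invfM Lpnorm_prod//.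
apply: le_Lpnorm => // xi; rewrite partial_fourier_L2.
rewrite [leRHS]ger0_norm ?Lpnorm_ge0// ger0_norm; last first.
  by rewrite mulr_ge0// sumr_ge0// => eta _; exact: sqr_ge0.
apply: le_trans (mean_le_Lpnorm _ (card_rVV _) P1).
by rewrite ler_wpM2l// ler_sum// => eta _; rewrite ler_norm.
Qed.

(** The average over xi of H(xi, y + s xi) is the adjoint of the Kakeya
    averages. Paired with f and grouped by z = y + s xi, it involves the sums
    of f over the lines { (z - s xi, s) } of direction - xi, each bounded by
    the maximal function at - xi; Hoelder in xi finishes. *)
Lemma slice_energy_le (H : V -> V -> R) : (forall xi z, 0 <= H xi z) ->
  Lpnorm 1 (q / 2%:E)%E (fun w : V * F =>
    N^-1 * \sum_xi H xi (w.1 + w.2 *: xi)) <=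
  K * Lpnorm N^-1 (p / 2%:E)%E (fun xi => \sum_z H xi z).
Proof.
move=> H0; have conjP' := dual_exponents_sym conjP.
have N0 : 0 < N^-1 by rewrite invr_gt0 natr_card_rV_gt0.
have B_ge0 (w : V * F) : 0 <= N^-1 * \sum_xi H xi (w.1 + w.2 *: xi).
  by rewrite mulr_ge0 ?(ltW N0)// sumr_ge0.
have [f [f0 f1 <-]] := Lpnorm_dual ltr01 conjQ B_ge0.
(* f lives on pairs (y, t); f' is the same function on F^n *)
have [g gK Kg] := @spacetime_bij F d.
pose f' (u : 'rV[F]_(d + 1)) : R[i] := (f (g u))%:C.
have f'E y t : normc (f' (spacetime y t)) = f (y, t).
  rewrite normc_real -[spacetime y t]/(spacetime (y, t).1 (y, t).2).
  by rewrite gK ger0_norm.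
apply: (@le_trans _ _ (N^-1 * \sum_xi `|kakeya_maximal f' (- xi)| *
    `|\sum_z H xi z|)); last first.
  apply: le_trans (Lpnorm_hoelder _ _ N0 conjP') _.
  rewrite ler_wpM2r ?Lpnorm_ge0//.
  rewrite (Lpnorm_reindex _ _ (kakeya_maximal f') (inv_bij opprK)).
  have Q'1 := dual_exponents_ge1 (dual_exponents_sym conjQ).
  have P'1 := dual_exponents_ge1 conjP'.
  apply: le_trans (kakeya_constantP Q'1 P'1 f') _.
  rewrite ler_piMr ?kakeya_constant_ge0//.
  rewrite -(Lpnorm_reindex _ _ (fun u => normc (f' u)) spacetime_bij).
  by rewrite (eq_Lpnorm _ _ (b := f))// => -[y t]; rewrite f'E.
rewrite mul1r; under eq_bigr do rewrite mulrCA mulr_sumr.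
rewrite -mulr_sumr ler_wpM2l ?(ltW N0)// exchange_big; apply: ler_sum => xi _.
rewrite ger0_norm ?bigmax_ge_id// ger0_norm ?sumr_ge0// mulr_sumr.
have -> : \sum_w f w * H xi (w.1 + w.2 *: xi) =
    \sum_(t : F) \sum_(y : V) f (y, t) * H xi (y + t *: xi).
  by rewrite exchange_big pair_bigA; apply: eq_bigr => -[].
(* substitute y = z - t xi *)
under eq_bigr => t _ do rewrite (reindex_inj (addIr (- (t *: xi)))).
rewrite exchange_big; apply: ler_sum => z _; under eq_bigr do rewrite subrK.
rewrite -mulr_suml ler_wpM2r//.
apply: le_trans (le_bigmax _ (fun x => \sum_(u in line x (- xi)) normc (f' u)) z).
rewrite sum_over_line; apply: ler_sum => t _.
by rewrite f'E scalerN.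
Qed.

(** The L^2 restriction estimate is applied on every slice, with the data
    G^(xi, y + s xi) of that slice. The powers of the three factors are compared
    after squaring, which is where the exponent 1/2 of K comes from. *)
Lemma tilde_le_restriction_kakeya : RT <= RS 2%:E q * K `^ 2^-1.
Proof.
have RS0 : 0 <= RS 2%:E q.
  apply: (restriction_constant_ge0 _ (@paraboloid_point_inj F d) paraboloidE).
    exact: card_rV_gt0.
  by rewrite lee_fin ler1n.
have K0 : 0 <= K.
  exact/kakeya_constant_ge0/(dual_exponents_ge1 (dual_exponents_sym conjQ)).
apply: (restriction_constant_le (@tilde_paraboloid_point_inj F d)
  tilde_paraboloidE card_VV_gt0 p1) => G.
rewrite -(@ler_pXn2r _ 2) ?nnegrE ?mulr_ge0 ?powR_ge0 ?Lpnorm_ge0//.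
rewrite !exprMn powR12_sqrt// sqr_sqrtr//.
apply: le_trans (_ : _ <= RS 2%:E q ^+ 2 * (K * Lpnorm N^-1 (p / 2%:E)%E
  (fun xi => \sum_z normc (partial_fourier G xi z) ^+ 2))) _; last first.
  by rewrite -mulrA !ler_wpM2l ?sqr_ge0// fiber_energy_le.
apply: le_trans (_ : _ <= RS 2%:E q ^+ 2 * _) _; last first.
  apply: ler_wpM2l; first exact: sqr_ge0.
  by apply: slice_energy_le => xi z; exact: sqr_ge0.
rewrite Lpnorm_tilde_extension Lpnorm_sqr// -ge0_LpnormZ ?sqr_ge0//.
apply: le_Lpnorm => // w; set h := fun xi => partial_fourier _ _ _.
rewrite !ger0_norm ?sqr_ge0//; last first.
  rewrite mulr_ge0 ?sqr_ge0// mulr_ge0// sumr_ge0// => xi _; exact: sqr_ge0.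
have -> : N^-1 * \sum_xi normc (h xi) ^+ 2 =
    Lpnorm N^-1 2%:E (fun xi => normc (h xi)) ^+ 2.
  rewrite Lpnorm_sqr// divee ?eqe ?pnatr_eq0//.
  rewrite Lpnorm1//; congr (_ * _); apply: eq_bigr => xi _.
  by rewrite ger0_norm ?sqr_ge0.
rewrite -exprMn; apply: lerXn2r; rewrite ?nnegrE ?mulr_ge0 ?Lpnorm_ge0//.
apply: (restriction_constantP e_circle (@paraboloid_point_inj F d)
  paraboloidE) => //; first exact: card_rV_gt0.
by rewrite lee_fin ler1n.
Qed.

End Exponents.
End RestrictionKakeya.

(** |F^(n-1)| = |F|^(n-1), |F^n| = |F|^n and 1 / (q/2) = 2 / q, with
    d = n - 1; at q = +oo both reciprocals are 0. *)
Lemma averaging_loss_powR (R : realType) (F : finFieldType) (d : nat)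
    (q : \bar R) : (2%:E <= q)%E ->
  #|{: 'rV[F]_d}|%:R / #|{: 'rV[F]_(d + 1)}|%:R `^ fine ((q / 2%:E)^-1)%E =
  #|F|%:R `^ (d.+1%:R - 1 - (2 * d.+1)%:R * fine (q^-1)%E) :> R.
Proof.
move=> q2; have F0 : #|F|%:R != 0 :> R.
  by rewrite pnatr_eq0 -lt0n; apply/card_gt0P; exists 0.
have -> : fine ((q / 2%:E)^-1)%E = 2 * fine (q^-1)%E.
  case: q q2 => [r||] //; last first.
    by rewrite inver pnatr_eq0/= mulyr gtr0_sg ?invr_gt0// mul1e invey mulr0.
  by rewrite inver pnatr_eq0/= -EFinM !fine_invr invfM invrK mulrC.
rewrite powRB ?F0 ?implybT//; congr (_ / _).
  by rewrite -natr1 addrK powR_mulrn// card_mx mul1n natrX.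
rewrite card_mx mul1n natrX -powR_mulrn// -powRrM addn1 natrM.
by rewrite mulrA [2 * _]mulrC.
Qed.

Theorem theorem9p1 (R : realType) (F : finFieldType)
    (c : nat) (hc : c \in [pchar F]) (hc2 : (2 < c)%N)
    (e : F -> R[i])
    (e_circle : forall x : F, normc (e x) = 1)
    (eD : forall x y : F, e (x + y) = e x * e y)
    (e_nonprincipal : ~ (forall x : F, e x = 1))
    (n : nat) (hn : (2 <= n)%N)
    (p q : \bar R) (hp : (2%:E <= p)%E) (hq : (2%:E <= q)%E) :
  let S := paraboloid F n.-1 in
  let tS := tilde_paraboloid F n.-1 in
  let K := kakeya_constant F n.-1
             (hoelder_conjugate (q / 2%:E)%E) (hoelder_conjugate (p / 2%:E)%E) in
  [/\ restriction_constant e S p q <= restriction_constant e tS p q,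
      K <= restriction_constant e tS p q ^+ 2
           * #|F|%:R `^ (n%:R - 1 - (2 * n)%:R * fine (q^-1)%E)
    & restriction_constant e tS p q
        <= restriction_constant e S 2%:E q * K `^ 2^-1].
Proof.
case: n hn => // d _ /=; split.
- exact: restriction_le_tilde.
- apply: le_trans (kakeya_le_tilde e_circle eD e_nonprincipal hp hq) _.
  by rewrite averaging_loss_powR.
- exact: tilde_le_restriction_kakeya.
Qed.
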